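(* Suppose that $\mathcal{C}$ is a root class of groups consisting only of periodic groups, $X$ is a $\mathcal{C}$-bounded nilpotent group, and $Y$ is a subgroup of $X$. Then the $\mathfrak{P}(\mathcal{C})'$-isolator $\mathfrak{P}(\mathcal{C})'\mbox{-}\mathfrak{Is}(X, Y)$ is $\mathcal{C}$-separable in $X$ and coincides with the set $\mathfrak{P}(\mathcal{C})'\mbox{-}\mathfrak{Rt}(X, Y)$. In particular, $X$ has the property $\mathcal{C}\mbox{-}\mathfrak{Sep}$. If $X$ is $\mathfrak{P}(\mathcal{C})'$-torsion-free, then $Y$ and $\mathfrak{P}(\mathcal{C})'\mbox{-}\mathfrak{Is}(X, Y)$ have the same nilpotency classes.
   Context: As usual, classes of groups are closed under isomorphism. A class of groups $\mathcal{C}$ is called a root class if it contains at least one non-trivial group and is closed under taking subgroups, extensions, and Cartesian (i.e. unrestricted direct) products of the form $\prod_{y \in Y} X_{y}$, where $X, Y \in \mathcal{C}$ and $X_{y}$ is an isomorphic copy of $X$ for each $y \in Y$. For a class of periodic groups $\mathcal{C}$, $\mathfrak{P}(\mathcal{C})$ denotes the set of all primes each of which divides the order of an element of some $\mathcal{C}$-group. For a set of primes $\mathfrak{P}$, $\mathfrak{P}'$ denotes the set of all primes not in $\mathfrak{P}$; a $\mathfrak{P}$-number is a positive integer all of whose prime divisors lie in $\mathfrak{P}$. A subgroup $Y$ of a group $X$ is $\mathfrak{P}'$-isolated in $X$ if, for any $x \in X$ and $q \in \mathfrak{P}'$, $x^{q} \in Y$ implies $x \in Y$. A group is $\mathfrak{P}'$-torsion-free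 if its trivial subgroup is $\mathfrak{P}'$-isolated. The $\mathfrak{P}'$-isolator $\mathfrak{P}'\mbox{-}\mathfrak{Is}(X, Y)$ is the smallest $\mathfrak{P}'$-isolated subgroup of $X$ containing $Y$; $\mathfrak{P}'\mbox{-}\mathfrak{Rt}(X, Y)$ is the set of all $x \in X$ such that $x^{q} \in Y$ for some $\mathfrak{P}'$-number $q$. A subgroup $Y$ of a group $X$ is $\mathcal{C}$-separable in $X$ if for any $x \in X \setminus Y$ there exists a homomorphism $\sigma$ of $X$ onto a group from $\mathcal{C}$ such that $x\sigma \notin Y\sigma$. For a class $\mathcal{C}$ of periodic groups, a group $X$ has the property $\mathcal{C}\mbox{-}\mathfrak{Sep}$ if all $\mathfrak{P}(\mathcal{C})'$-isolated subgroups of $X$ are $\mathcal{C}$-separable in $X$. For an abelian group $A$ and $p \in \mathfrak{P}(\mathcal{C})$, the subgroup of all elements of $p$-power order of $A$ is called a primary $\mathfrak{P}(\mathcal{C})$-component of $A$. An abelian group $A$ is $\mathcal{C}$-bounded if, for any quotient group $B$ of $A$, each primary $\mathfrak{P}(\mathcal{C})$-component of $B$ has a finite exponent and a cardinality not exceeding the cardinality of some $\mathcal{C}$-group. A nilpotent group is $\mathcal{C}$-bounded if it has at least one finite central series with $\mathcal{C}$-bounded abelian factors. *)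

(* Defs.v *)
(* Groups, finite or not, are inhabitants of [groupType]; sets of their       *)
(* elements are classical sets.                                               *)
From HB Require Import structures.
From mathcomp Require Import all_boot.
From mathcomp Require Import boolp classical_sets functions cardinality.

Set Implicit Arguments.
Unset Strict Implicit.
Unset Printing Implicit Defensive.

Local Open Scope group_scope.
Local Open Scope classical_set_scope.
Local Open Scope card_scope.

Section ElementsAndSubgroups.
Variable G : groupType.
Implicit Types (x y : G) (A H K : set G) (pi : nat_pred).

Definition has_order x (n : nat) : Prop :=
  [/\ (0 < n)%N, x ^+ n = 1 & forall m : nat, (0 < m < n)%N -> x ^+ m <> 1].

Definition periodic : Prop := forall x, exists n, has_order x n.

Definition subgroup H : Prop :=
  [/\ H 1, forall x y, H x -> H y -> H (x * y) & forall x, H x -> H x^-1].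

(* The complement [pi^'] of a [nat_pred] also contains the non-primes, whence  *)
(* the explicit primality condition.  In [pi^'.-nat q] only the prime          *)
(* divisors of [q] are tested, so no such care is needed in [root_set].        *)
Definition isolated pi H : Prop :=
  forall x (q : nat), prime q -> q \in pi -> H (x ^+ q) -> H x.

Definition torsion_free pi : Prop := isolated pi [set 1].

Definition isolator pi H : set G :=
  smallest (fun K => subgroup K /\ isolated pi K) H.

Definition root_set pi H : set G :=
  [set x | exists2 q : nat, pi.-nat q & H (x ^+ q)].

Lemma isolatorP pi H : subgroup (isolator pi H) /\ isolated pi (isolator pi H).
Proof.
split; first split.
- by move=> K [[[]]].
- by move=> x y Hx Hy K KH; case: (KH) => [[[_ KM _] _] _]; apply: KM (Hx K KH) (Hy K KH).
- by move=> x Hx K KH; case: (KH) => [[[_ _ KV] _] _]; apply: KV (Hx K KH).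
- move=> x q q_pr piq Hxq K KH; case: (KH) => [[_ isoK] _].
  exact: isoK q_pr piq (Hxq K KH).
Qed.

(* The condition [s i.+1 / s i] central in [A / s i] is written as             *)
(* [[s i.+1, A] <= s i]; it makes every term of the series normal in [A].      *)
Definition central_series A (n : nat) (s : nat -> set G) : Prop :=
  [/\ s 0 = [set 1], s n = A,
      forall i, (i <= n)%N -> subgroup (s i)
    & forall i, (i < n)%N -> s i `<=` s i.+1 /\
        forall x y, s i.+1 x -> A y -> s i [~ x, y]].

Definition has_nil_class A (c : nat) : Prop :=
  (exists s, central_series A c s) /\
  forall n s, central_series A n s -> (c <= n)%N.

Definition primary_component (p : nat) : set G :=
  [set x | exists k : nat, has_order x (p ^ k)%N].

End ElementsAndSubgroups.

Arguments periodic : clear implicits.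
Arguments torsion_free : clear implicits.
Arguments primary_component : clear implicits.

Definition isomorphic (G H : groupType) : Prop :=
  exists f : {multiplicative G -> H}, bijective f.

(* [Q] is isomorphic to the quotient [K / H] of subgroups of [G]: it is the    *)
(* image of [K] under a homomorphism defined on [K] and with kernel [H].       *)
Definition is_quotient (G : groupType) (K H : set G) (Q : groupType) : Prop :=
  exists f : G -> Q,
    [/\ forall x y, K x -> K y -> f (x * y) = f x * f y,
        f @` K = [set: Q]
      & [set x | K x /\ f x = 1] = H].

Definition cart_prod (Y : Type) (X_ : Y -> groupType) : Type := forall y, X_ y.

Section CartProd.
Variables (Y : Type) (X_ : Y -> groupType).
Local Notation P := (cart_prod X_).

HB.instance Definition _ := gen_eqMixin P.
HB.instance Definition _ := gen_choiceMixin P.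

Definition cart_one : P := fun=> 1.
Definition cart_mul (f g : P) : P := fun y => f y * g y.
Definition cart_inv (f : P) : P := fun y => (f y)^-1.

Fact cart_mulA : associative cart_mul.
Proof. by move=> f g h; apply: functional_extensionality_dep => y; apply: mulgA. Qed.
Fact cart_mul1g : left_id cart_one cart_mul.
Proof. by move=> f; apply: functional_extensionality_dep => y; apply: mul1g. Qed.
Fact cart_mulg1 : right_id cart_one cart_mul.
Proof. by move=> f; apply: functional_extensionality_dep => y; apply: mulg1. Qed.
Fact cart_mulVg : left_inverse cart_one cart_inv cart_mul.
Proof. by move=> f; apply: functional_extensionality_dep => y; apply: mulVg. Qed.
Fact cart_mulgV : right_inverse cart_one cart_inv cart_mul.
Proof. by move=> f; apply: functional_extensionality_dep => y; apply: mulgV. Qed.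

HB.instance Definition _ :=
  isGroup.Build P cart_mulA cart_mul1g cart_mulg1 cart_mulVg cart_mulgV.
End CartProd.

(* Subgroups are given by injective homomorphisms, and an extension of [N] by  *)
(* [Q] by a short exact sequence 1 -> N -> G -> Q -> 1.                        *)
Record root_class (C : groupType -> Prop) : Prop := RootClass {
  root_isomorphic : forall G H : groupType, isomorphic G H -> C G -> C H;
  root_nontrivial : exists2 G : groupType, C G & exists x : G, x <> 1;
  root_subgroup : forall (G H : groupType) (f : {multiplicative H -> G}),
    injective f -> C G -> C H;
  root_extension : forall (N G Q : groupType)
      (i : {multiplicative N -> G}) (p : {multiplicative G -> Q}),
    injective i -> range p = [set: Q] -> range i = [set g | p g = 1] ->
    C N -> C Q -> C G;
  root_cart_prod : forall (X Y : groupType) (X_ : Y -> groupType),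
    C X -> C Y -> (forall y, isomorphic X (X_ y)) -> C (cart_prod X_ : groupType)
}.

Section PropertiesRelativeToAClass.
Variable C : groupType -> Prop.

Definition primes_of : nat_pred :=
  [pred p | prime p &
    `[< exists (G : groupType) (x : G) (n : nat),
          [/\ C G, has_order x n & p %| n] >]].

Definition separable (X : groupType) (Y : set X) : Prop :=
  forall x, ~ Y x ->
    exists (Q : groupType) (f : {multiplicative X -> Q}),
      [/\ C Q, range f = [set: Q] & ~ (f @` Y) (f x)].

Definition Sep (X : groupType) : Prop :=
  forall Y : set X, subgroup Y -> isolated primes_of^' Y -> separable Y.

(* The quotient groups of [A] are its homomorphic images.                      *)
Definition bounded_abelian (A : groupType) : Prop :=
  (forall x y : A, commute x y) /\
  forall (B : groupType) (f : {multiplicative A -> B}), range f = [set: B] ->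
  forall p, p \in primes_of ->
    (exists2 e : nat, (0 < e)%N &
       forall b, primary_component B p b -> b ^+ e = 1) /\
    (exists2 D : groupType, C D & primary_component B p #<= [set: D]).

Definition bounded_nilpotent (X : groupType) : Prop :=
  exists (n : nat) (s : nat -> set X),
    central_series [set: X] n s /\
    forall i, (i < n)%N ->
      exists2 Q : groupType, is_quotient (s i.+1) (s i) Q & bounded_abelian Q.

End PropertiesRelativeToAClass.

(* Main.v *)
From HB Require Import structures.
Require Import Defs.
From mathcomp Require Import all_boot.
From mathcomp Require Import boolp classical_sets functions cardinality.

Set Implicit Arguments.
Unset Strict Implicit.
Unset Printing Implicit Defensive.

Local Open Scope group_scope.
Local Open Scope classical_set_scope.
Local Open Scope card_scope.

(** Write pi for the set of primes outside [primes_of C], R(H) for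
    [root_set pi H], and fix a central series s_0 <= ... <= s_n of the ambient
    group.

    Roots ([root_set_mul]).  R(H) is closed under products, by induction on the
    class of a group A containing H.  Put N = s_(n-1).  For each a in A the
    subgroup N<a> has smaller class, because a commutes with itself and N is
    central modulo s_(n-2); hence R(H) meets N<a> in a subgroup.  Applying this
    to a = x, where x lies in R(H), one finds that any two elements of R(H)
    commute modulo V, the intersection of R(H) and N, so that
    (xy)^m = x^m y^m v with v in V, and R(H) absorbs V.  It follows at once that
    R(H) is the isolator of H.

    Separation.  Let Y be isolated and x outside Y.  After passing to a power of
    x and enlarging Y, one has x^p in Y for some prime p of [primes_of C]
    ([exists_power_outside]).  Choose M maximal among the subgroups that contain
    Y and avoid x.  The point is that the p^k-th power of every element of X
    lies in M, for one k ([maximal_finite_exponent]); the proof goes up the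
    central series.  If s_j has exponent p^k relative to M, then for g in
    s_(j+1) a power h of g by a power of p is central modulo the normal core of
    M, so h normalises M.  Unless h is already in M, maximality puts x in M<h>,
    and x^p in M then forces a positive power of h, hence (M being closed under
    roots prime to p) a p-power power of h, into M.  Boundedness makes the
    exponents uniform on s_(j+1).  So the quotient of X by the core of M has
    exponent p^k, and it separates x from Y; it belongs to C by
    [root_quotient], since each of its central factors is an abelian group of
    exponent p^k no larger than some group of C, and such a group is an iterated
    extension of subgroups of Cartesian powers of a group containing an element
    of order p.

    Nilpotency class ([nil_class_root_set]).  In a pi-torsion-free nilpotent
    group m-th roots are unique for pi-numbers m ([root_unique]).  Hence an
    element commuting with Y commutes with R(Y), and the quotient by the centre
    is again pi-torsion-free.  Induction on the class of Y, killing the centre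
    of R(Y), bounds the class of R(Y) by that of Y. *)

(** * Homomorphisms, subgroups and quotients *)

Lemma hom1 (G H : groupType) (f : {multiplicative G -> H}) : f 1 = 1.
Proof. by apply: (mulgI (f 1)); rewrite -gmulfM !mulg1. Qed.

(** Between groups, multiplicativity alone makes a map preserve 1, hence
    inverses, conjugates and commutators. *)
Definition group_hom (G H : groupType) (f : {multiplicative G -> H}) :
    UMagmaMorphism.type G H :=
  HB.pack (f : G -> H) (Multiplicative.on (f : G -> H))
    (Multiplicative_isUMagmaMorphism.Build G H f (hom1 f)).

Section HomLemmas.
Variables (G H : groupType) (f : {multiplicative G -> H}).

Lemma homM x y : f (x * y) = f x * f y.
Proof. exact: gmulfM. Qed.
Lemma homV x : f x^-1 = (f x)^-1.
Proof. exact: (gmulfV (group_hom f)). Qed.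
Lemma homX n x : f (x ^+ n) = f x ^+ n.
Proof. exact: (gmulfXn (group_hom f)). Qed.
Lemma homJ x y : f (x ^ y) = f x ^ f y.
Proof. exact: (gmulfJ (group_hom f)). Qed.
Lemma homR x y : f [~ x, y] = [~ f x, f y].
Proof. exact: (gmulfR (group_hom f)). Qed.
Lemma hom_inj : (forall x, f x = 1 -> x = 1) -> injective f.
Proof. exact: (gmulf_inj (f := group_hom f)). Qed.
End HomLemmas.

Definition hom_of (G H : groupType) (f : G -> H)
    (fM : {morph f : x y / x * y}) : {multiplicative G -> H} :=
  HB.pack f (isMultiplicative.Build G H f fM).

Definition subg_type (G : groupType) (H : set G) (sH : subgroup H) : Type :=
  {x : G | `[< H x >]}.

Section SubgType.
Variables (G : groupType) (H : set G) (sH : subgroup H).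
Local Notation T := (subg_type sH).

Fact subg_group_closed : group_closed (fun x : G => `[< H x >]).
Proof.
case: sH => H1 HM HV; split; first exact: asboolT.
by move=> x y /asboolP Hx /asboolP Hy; apply: asboolT; apply/HM/HV.
Qed.

HB.instance Definition _ := SubChoice.on T.
HB.instance Definition _ :=
  SubChoice_isSubGroup.Build G (fun x : G => `[< H x >]) T subg_group_closed.

Definition subg_in (x : G) (Hx : H x) : T := exist _ x (introT (asboolP _) Hx).

Definition subg_val : {multiplicative T -> G} := hom_of (@valM _ _ T).

Lemma subg_valP (u : T) : H (subg_val u).
Proof. by case: u => x /= /asboolP. Qed.

Lemma subg_inK (x : G) (Hx : H x) : subg_val (subg_in Hx) = x.
Proof. by []. Qed.

Lemma subg_val_inj : injective subg_val.
Proof. exact: val_inj. Qed.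

Lemma range_subg_val : range subg_val = H.
Proof.
apply/seteqP; split=> [_ [u _ <-]|x Hx]; first exact: subg_valP.
by exists (subg_in Hx).
Qed.

End SubgType.

Definition normal (G : groupType) (N : set G) : Prop :=
  subgroup N /\ forall x y, N x -> N (x ^ y).

(** The quotient is carried by a transversal: the points fixed by the choice of
    one representative in each coset. *)
Definition coset_repr (G : groupType) (N : set G) (x : G) : G :=
  xget 1 [set y | N (x^-1 * y)].

Definition quotient_type (G : groupType) (N : set G) (nN : normal N) : Type :=
  {x : G | coset_repr N x == x}.

Section Quotient.
Variables (G : groupType) (N : set G) (nN : normal N).
Local Notation Q := (quotient_type nN).
Local Notation repr := (coset_repr N).

Lemma coset_reprP x : N (x^-1 * repr x).
Proof.
apply: (@xgetPex G 1 [set y | N (x^-1 * y)]).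
by exists x; rewrite /= mulVg; case: nN => -[].
Qed.

Lemma eq_coset_repr x y : repr x = repr y <-> N (x^-1 * y).
Proof.
case: nN => -[N1 NM NV] NJ; split=> [e|Nxy].
  have := NM _ _ (coset_reprP x) (NV _ (coset_reprP y)).
  by rewrite e invgM invgK -mulgA mulVKg.
congr xget; apply/seteqP; split=> z /= Nz.
  by rewrite -[z](mulVKg x) mulgA; apply: NM => //; rewrite -[x]invgK -invgM; apply: NV.
by rewrite -[z](mulVKg y) mulgA; apply: NM.
Qed.

Lemma coset_repr_id x : repr (repr x) = repr x.
Proof. by apply/esym/eq_coset_repr/coset_reprP. Qed.

HB.instance Definition _ := SubChoice.on Q.

Definition coset_of (x : G) : Q := exist _ (repr x) (introT eqP (coset_repr_id x)).

Lemma coset_of_eq x y : coset_of x = coset_of y <-> N (x^-1 * y).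
Proof.
split=> [[/eq_coset_repr]//|/eq_coset_repr e].
by apply: val_inj.
Qed.

Lemma coset_ofK (u : Q) : coset_of (val u) = u.
Proof. by apply: val_inj; case: u => x /= /eqP. Qed.

Definition quo_mul (u v : Q) : Q := coset_of (val u * val v).
Definition quo_one : Q := coset_of 1.
Definition quo_inv (u : Q) : Q := coset_of (val u)^-1.

Lemma coset_ofM x y : quo_mul (coset_of x) (coset_of y) = coset_of (x * y).
Proof.
case: nN => -[N1 NM NV] NJ.
apply/esym/coset_of_eq => /=.
have -> : (x * y)^-1 * (repr x * repr y) =
  (x^-1 * repr x) ^ y * (y^-1 * repr y).
  by rewrite conjgE invgM -!mulgA mulVKg.
by apply: NM; [apply: NJ|]; apply: coset_reprP.
Qed.

Lemma coset_ofV x : quo_inv (coset_of x) = coset_of x^-1.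
Proof.
case: nN => -[N1 NM NV] NJ.
apply/coset_of_eq; rewrite /= invgK.
have -> : repr x * x^-1 = (x^-1 * repr x) ^ x^-1.
  by rewrite conjgE invgK !mulgA mulgV mul1g.
by apply: NJ; apply: coset_reprP.
Qed.

Fact quo_mulA : associative quo_mul.
Proof.
by move=> u v w; rewrite -(coset_ofK u) -(coset_ofK v) -(coset_ofK w) !coset_ofM mulgA.
Qed.
Fact quo_mul1g : left_id quo_one quo_mul.
Proof. by move=> u; rewrite -(coset_ofK u) coset_ofM mul1g. Qed.
Fact quo_mulg1 : right_id quo_one quo_mul.
Proof. by move=> u; rewrite -(coset_ofK u) coset_ofM mulg1. Qed.
Fact quo_mulVg : left_inverse quo_one quo_inv quo_mul.
Proof. by move=> u; rewrite -(coset_ofK u) coset_ofV coset_ofM mulVg. Qed.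
Fact quo_mulgV : right_inverse quo_one quo_inv quo_mul.
Proof. by move=> u; rewrite -(coset_ofK u) coset_ofV coset_ofM mulgV. Qed.

HB.instance Definition _ :=
  isGroup.Build Q quo_mulA quo_mul1g quo_mulg1 quo_mulVg quo_mulgV.

End Quotient.

Lemma quotient_exists (G : groupType) (N : set G) : normal N ->
  exists (Q : groupType) (f : {multiplicative G -> Q}),
    range f = [set: Q] /\ forall x, f x = 1 <-> N x.
Proof.
move=> nN; have fM : {morph coset_of nN : x y / x * y}.
  by move=> x y; rewrite -coset_ofM.
exists (quotient_type nN : groupType), (hom_of fM); split.
  by apply/seteqP; split=> // u _; exists (val u) => //; apply: coset_ofK.
move=> x; rewrite -[X in _ = X]/(coset_of nN 1) /=.
split=> [/esym/coset_of_eq|Nx]; first by rewrite invg1 mul1g.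
by apply/esym/coset_of_eq; rewrite invg1 mul1g.
Qed.

(** * Products of subgroups and central series *)

Section Subgroups.
Variable G : groupType.
Implicit Types (x y g h w : G) (A H K M N S W : set G).

Lemma subgroupX H x n : subgroup H -> H x -> H (x ^+ n).
Proof.
case=> H1 HM _ Hx; elim: n => [|n IHn]; first by rewrite expg0.
by rewrite expgS; apply: HM.
Qed.

Lemma subgroupR H x y : subgroup H -> H x -> H y -> H [~ x, y].
Proof.
case=> _ HM HV Hx Hy; rewrite /commg /conjg.
exact: HM (HV _ Hx) (HM _ _ (HV _ Hy) (HM _ _ Hx Hy)).
Qed.

Lemma subgroupJ H x y : subgroup H -> H x -> H y -> H (x ^ y).
Proof.
by case=> _ HM HV Hx Hy; exact: HM (HV _ Hy) (HM _ _ Hx Hy).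
Qed.

Lemma subgroupMl H x y : subgroup H -> H x -> H (x * y) <-> H y.
Proof.
case=> _ HM HV Hx; split=> [Hxy|]; last exact: HM.
by rewrite -[y](mulKg x); apply: HM; first exact: HV.
Qed.

Lemma subgroupMr H x y : subgroup H -> H y -> H (x * y) <-> H x.
Proof.
case=> _ HM HV Hy; split=> [Hxy|Hx]; last exact: HM.
by rewrite -[x](mulgK y); apply: HM; last exact: HV.
Qed.

Lemma subgroupVE H x : subgroup H -> H x^-1 <-> H x.
Proof. by case=> _ _ HV; split=> [/HV|/HV//]; rewrite invgK. Qed.

Lemma subgroupT : subgroup [set: G].
Proof. by []. Qed.

Lemma subgroup1 : subgroup [set 1 : G].
Proof. by split=> // [x y -> ->|x ->] /=; rewrite ?mulg1 ?invg1. Qed.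

Lemma subgroupI H K : subgroup H -> subgroup K -> subgroup (H `&` K).
Proof.
move=> [H1 HM HV] [K1 KM KV]; split=> // [x y [? ?] [? ?]|x [? ?]].
  by split; [apply: HM|apply: KM].
by split; [apply: HV|apply: KV].
Qed.

Lemma conjg_commg x y : x ^ y = x * [~ x, y].
Proof. by rewrite commgEl mulVKg. Qed.

Definition normalizer W : set G := [set h | forall w, W (w ^ h) <-> W w].

Lemma subgroup_normalizer W : subgroup (normalizer W).
Proof.
split=> [w|x y Nx Ny w|x Nx w]; first by rewrite conjg1.
  by rewrite conjgM Ny.
by rewrite -Nx conjgKV.
Qed.

Lemma sub_normalizer A W : subgroup A ->
  (forall w a, W w -> A a -> W (w ^ a)) -> A `<=` normalizer W.
Proof.
move=> [_ _ AV] WJ a Aa w; split=> [Wwa|Ww]; last exact: WJ.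
by rewrite -[w](conjgK a); apply: WJ => //; apply: AV.
Qed.

Lemma subgroup_normalizes W : subgroup W -> W `<=` normalizer W.
Proof. by move=> sW; apply: sub_normalizer => // w a; apply: subgroupJ. Qed.

(** For a subgroup [S] this is the product W S; writing its elements as
    w t^-1 avoids a second existential. *)
Definition join W S : set G := [set g | exists2 t, S t & W (g * t)].

Lemma subgroup_join W S :
  subgroup W -> subgroup S -> S `<=` normalizer W -> subgroup (join W S).
Proof.
move=> sW [S1 SM SV] nWS; have [W1 WM WV] := sW.
split=> [|x y [t St Wxt] [u Su Wyu]|x [t St Wxt]].
- by exists 1; rewrite ?mulg1.
- exists (u * t); first exact: SM.
  have -> : x * y * (u * t) = (x * t) * (y * u) ^ t.
    by rewrite conjgE !mulgA mulgK.
  by apply: WM => //; apply/nWS.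
- exists t^-1; first exact: SV.
  rewrite -invgM; apply/WV.
  by apply/(nWS _ St); rewrite conjgE -mulgA mulKg.
Qed.

Lemma join_subl W S : S 1 -> W `<=` join W S.
Proof. by move=> S1 w Ww; exists 1; rewrite ?mulg1. Qed.

Lemma join_subr W S : W 1 -> subgroup S -> S `<=` join W S.
Proof. by move=> W1 [_ _ SV] t St; exists t^-1; [apply: SV|rewrite mulgV]. Qed.

Lemma join_min W S A : subgroup A -> W `<=` A -> S `<=` A -> join W S `<=` A.
Proof.
by move=> sA WA SA g [t St Wgt]; apply/(subgroupMr g sA (SA t St))/WA.
Qed.

(** Powers with exponents in the integers, as quotients of natural ones. *)
Definition cyclic h : set G := [set t | exists a b, t = h ^+ a * h ^- b].

Lemma cyclic_id h : cyclic h h.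
Proof. by exists 1%N, 0%N; rewrite expg1 expg0 divg1. Qed.

Lemma commuteXV h a b : commute (h ^+ a) (h ^- b).
Proof. by apply: commuteV; apply: commuteX2. Qed.

Lemma subgroup_cyclic h : subgroup (cyclic h).
Proof.
split=> [|_ _ [a [b ->]] [c [d ->]]|_ [a [b ->]]].
- by exists 0%N, 0%N; rewrite expg0 divg1.
- exists (a + c)%N, (b + d)%N; rewrite expgnDr (addnC b) (expgnDr h d) invgM.
  by rewrite !mulgA -[_ * _ * h ^+ c]mulgA -(commuteXV h c b) !mulgA.
- by exists b, a; rewrite invgM invgK.
Qed.

Lemma cyclic_min A h : subgroup A -> A h -> cyclic h `<=` A.
Proof.
move=> sA Ah _ [a [b ->]]; case: (sA) => _ AM AV.
by apply: (AM); [|apply: AV]; apply: subgroupX.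
Qed.

Lemma cyclic_pow A h a b : subgroup A -> A (h ^+ a * h ^- b) -> a != b ->
  exists2 t, (0 < t)%N & A (h ^+ t).
Proof.
move=> sA; case: ltngtP => // ab Aab _; last first.
  by exists (a - b)%N; [rewrite subn_gt0|rewrite expgnFr // ltnW].
exists (b - a)%N; first by rewrite subn_gt0.
by rewrite expgnFr 1?ltnW //; apply/(subgroupVE _ sA); rewrite invgM invgK.
Qed.

Lemma commMgJ x y z : [~ x * y, z] = [~ x, z] ^ y * [~ y, z].
Proof. by rewrite /commg /conjg !invgM -!mulgA !mulVKg. Qed.

Lemma commVg x y : [~ x^-1, y] = ([~ x, y] ^ x^-1)^-1.
Proof. by rewrite /commg /conjg !invgK -!mulgA mulVKg !invgM !invgK -!mulgA. Qed.

(** Being a subgroup, it reduces commutation modulo [S] on a product of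
    subgroups to commutation on the factors. *)
Definition centralizer_mod A S w : set G := [set g | A g /\ S [~ g, w]].

Lemma subgroup_centralizer_mod A S w : subgroup A -> subgroup S ->
  A `<=` normalizer S -> subgroup (centralizer_mod A S w).
Proof.
move=> sA sS nSA; have [A1 AM AV] := sA; have [S1 SM SV] := sS.
split=> [|x y [Ax Sx] [Ay Sy]|x [Ax Sx]]; first by rewrite /centralizer_mod /= comm1g.
  split; first exact: AM.
  by rewrite commMgJ; apply: SM => //; apply/nSA.
by split; [exact: AV|rewrite commVg; apply/SV/nSA => //; exact: AV].
Qed.

Section CentralSeries.
Variables (A : set G) (n : nat) (s : nat -> set G).
Hypothesis cs : central_series A n s.

Lemma cs_subgroup i : (i <= n)%N -> subgroup (s i).
Proof. by case: cs => _ _ + _; apply. Qed.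

Lemma cs_subS i : (i < n)%N -> s i `<=` s i.+1.
Proof. by case: cs => _ _ _ H /H []. Qed.

Lemma cs_sub i j : (i <= j <= n)%N -> s i `<=` s j.
Proof.
elim: j => [|j IHj]; first by rewrite leqn0 => /andP[/eqP-> _].
rewrite leq_eqVlt => /andP[/orP[/eqP-> _|ij] jn]; first exact: subset_refl.
by apply: subset_trans (cs_subS jn); apply: IHj; rewrite -ltnS ij ltnW.
Qed.

Lemma cs_top : s n = A. Proof. by case: cs. Qed.

Lemma cs_subT i : (i <= n)%N -> s i `<=` A.
Proof. by move=> i_n; rewrite -cs_top; apply: cs_sub; rewrite i_n leqnn. Qed.

Lemma cs_group : subgroup A.
Proof. by rewrite -cs_top; exact: cs_subgroup (leqnn n). Qed.

Lemma cs_comm i x y : (i < n)%N -> s i.+1 x -> A y -> s i [~ x, y].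
Proof. by case: cs => _ _ _ H /H [_]; apply. Qed.

Lemma cs_comm' i x y : (i < n)%N -> A x -> s i.+1 y -> s i [~ x, y].
Proof.
move=> i_n Ax sy; rewrite -invgR; case: (cs_subgroup (ltnW i_n)) => _ _.
by apply; apply: cs_comm.
Qed.

Lemma cs_conj i x y : (i <= n)%N -> s i x -> A y -> s i (x ^ y).
Proof.
case: i => [|i] i_n sx Ay.
  by move: sx; case: cs => -> _ _ _ ->; rewrite conj1g.
rewrite conjg_commg; have [_ sM _] := cs_subgroup i_n.
by apply: sM => //; apply/(cs_subS i_n)/cs_comm.
Qed.

Lemma cs_normalizer i : (i <= n)%N -> A `<=` normalizer (s i).
Proof.
by move=> i_n; apply: sub_normalizer cs_group _ => w a; apply: cs_conj.
Qed.

Lemma subgroup_join_cs H i : subgroup H -> H `<=` A -> (i <= n)%N ->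
  subgroup (join (s i) H).
Proof.
move=> sH HA i_n; apply: subgroup_join => //; first exact: cs_subgroup.
exact: subset_trans HA (cs_normalizer i_n).
Qed.

Lemma cs_restrict H : subgroup H -> H `<=` A ->
  central_series H n (fun i => s i `&` H).
Proof.
move=> sH HA; split.
- case: cs => -> _ _ _; apply/seteqP; split=> x /=; first by case.
  by move=> ->; split=> //; case: sH.
- by rewrite cs_top; apply/setIidPr.
- by move=> i i_n; apply: subgroupI => //; apply: cs_subgroup.
- move=> i i_n; split; first by apply: setSI; apply: cs_subS.
  move=> x y [sx Hx] Hy; split; last exact: subgroupR.
  by apply: cs_comm => //; apply: HA.
Qed.

End CentralSeries.

(** Adjoining one element to the last proper term of a central series gives
    a subgroup of smaller class: modulo the previous term, that element
    commutes with itself and with a central subgroup. *)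
Lemma cs_join_cyclic A n s x : central_series A n.+2 s -> A x ->
  central_series (join (s n.+1) (cyclic x)) n.+1
    (fun i => if (i <= n)%N then s i else join (s n.+1) (cyclic x)).
Proof.
move=> cs Ax; set K := join _ _.
have sA := cs_group cs.
have sN : subgroup (s n.+1) by apply: (cs_subgroup cs).
have sn : subgroup (s n) by apply: (cs_subgroup cs); apply: leqW.
have cA : cyclic x `<=` A by apply: cyclic_min.
have NA : s n.+1 `<=` A by apply: (cs_subT cs).
have sK : subgroup K by apply: (subgroup_join_cs cs) => //; apply: subgroup_cyclic.
have KA : K `<=` A by apply: join_min.
have nA : A `<=` normalizer (s n) by apply: (cs_normalizer cs); apply: leqW.
have sC w := subgroup_centralizer_mod w sA sn nA.
have NC w : A w -> s n.+1 `<=` centralizer_mod A (s n) w.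
  by move=> Aw v Nv; split; [apply: NA|apply: (cs_comm cs)].
have Kx : K `<=` centralizer_mod A (s n) x.
  apply: join_min => //; first exact: NC.
  by apply: cyclic_min => //; split=> //; rewrite commgg; case: sn.
have Kab a b : K a -> K b -> s n [~ a, b].
  move=> Ka Kb; suff : K `<=` centralizer_mod A (s n) b by move/(_ a Ka) => [].
  apply: join_min => //; first by apply/NC/KA.
  apply: cyclic_min => //; split=> //; rewrite -invgR.
  by case: sn => _ _; apply; case: (Kx b Kb).
split; first by case: cs.
- by rewrite ltnn.
- by move=> i _; case: ifP => // i_n; apply: (cs_subgroup cs); rewrite !leqW.
move=> i; rewrite ltnS => i_n; rewrite i_n; case: ltnP => ni; last first.
  have -> : i = n by apply/eqP; rewrite eqn_leq i_n.
  split=> //; apply: subset_trans (join_subl _); last by case: (subgroup_cyclic x).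
  by apply: (cs_subS cs); apply: leqW.
have i2 : (i < n.+2)%N by rewrite (leq_trans ni) // ltnW.
split; first exact: (cs_subS cs).
by move=> a b sa /KA Ab; apply: (cs_comm cs).
Qed.

End Subgroups.

(** * Roots of a subgroup *)

Section Roots.
Variables (G : groupType) (pi : nat_pred).
Implicit Types (x y g h v w : G) (A H K M N S W : set G).
Local Notation R := (root_set pi).

Lemma sub_root_set H : H `<=` R H.
Proof. by move=> x Hx; exists 1%N. Qed.

Lemma root_set_root H x m : pi.-nat m -> R H (x ^+ m) -> R H x.
Proof. by move=> pm [q pq]; rewrite -expgnA; exists (m * q)%N; rewrite ?pnatM ?pm. Qed.

Lemma root_setX H x m : subgroup H -> R H x -> R H (x ^+ m).
Proof. by move=> sH [q pq Hq]; exists q => //; rewrite expgnAC; apply: subgroupX. Qed.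

Lemma root_setV H x : subgroup H -> R H x -> R H x^-1.
Proof. by move=> sH [q pq Hq]; exists q => //; rewrite expVgn; apply/subgroupVE. Qed.

Lemma root_setJ H x h : subgroup H -> R H x -> H h -> R H (x ^ h).
Proof. by move=> sH [q pq Hq] Hh; exists q => //; rewrite -conjXg; apply: subgroupJ. Qed.

Lemma root_set_common H x y : subgroup H -> R H x -> R H y ->
  exists m, [/\ pi.-nat m, H (x ^+ m) & H (y ^+ m)].
Proof.
move=> sH [a pa Hx] [b pb Hy]; exists (a * b)%N; rewrite pnatM pa pb expgnA.
by rewrite mulnC expgnA; split=> //; apply: subgroupX.
Qed.

Lemma root_setM_commute H x y :
  subgroup H -> R H x -> R H y -> commute x y -> R H (x * y).
Proof.
move=> sH Rx Ry xy; have [m [pm Hx Hy]] := root_set_common sH Rx Ry.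
by exists m; rewrite ?expgMn //; case: sH => _ HM _; apply: HM.
Qed.

(** Both factors are handled in the subgroups N<a>, of smaller class; V gathers
    the roots of H in N. *)
Lemma root_set_mul A n s H x y : central_series A n s -> subgroup H ->
  H `<=` A -> A x -> A y -> R H x -> R H y -> R H (x * y).
Proof.
elim: n A s H x y => [|[|n] IHn] A s H x y cs sH HA Ax Ay Rx Ry.
- move: Ax; rewrite -(cs_top cs); case: cs => -> _ _ _ -> /=; by rewrite mul1g.
- apply: root_setM_commute => //; apply/commgP/eqP.
  have := cs_comm cs (ltn0Sn 0); rewrite (cs_top cs); case: cs => -> _ _ _.
  by apply.
set N := s n.+1; have sN : subgroup N by apply: (cs_subgroup cs).
have sA := cs_group cs; have [_ AM AV] := sA.
have NA : N `<=` A by apply: (cs_subT cs).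
pose K a := join N (cyclic a).
have sK a : A a -> subgroup (K a).
  move=> Aa; apply: (subgroup_join_cs cs) => //; first exact: subgroup_cyclic.
  exact: cyclic_min.
have NK a : N `<=` K a by apply: join_subl; case: (subgroup_cyclic a).
have aK a : K a a.
  apply: join_subr (cyclic_id a) => //; last exact: subgroup_cyclic.
  by case: sN.
have RK a u v : A a -> K a u -> K a v -> R H u -> R H v -> R H (u * v).
  move=> Aa Ku Kv [q pq Hq] [r pr Hr].
  have sHK : subgroup (H `&` K a) by apply: subgroupI => //; apply: sK.
  have [t pt [Ht _]] : root_set pi (H `&` K a) (u * v).
    apply: (IHn _ _ _ _ _ (cs_join_cyclic cs Aa)) => //.
    - by exists q => //; split=> //; apply: subgroupX => //; apply: sK.
    - by exists r => //; split=> //; apply: subgroupX => //; apply: sK.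
  by exists t.
have comN a b : A a -> A b -> N [~ a, b].
  by move=> Aa Ab; apply: (cs_comm cs) => //; rewrite (cs_top cs).
pose V : set G := R H `&` N.
have VM a v : A a -> R H a -> V v -> R H (a * v).
  by move=> Aa Ra [Rv Nv]; apply: (RK a) => //; apply: NK.
have VV v : V v -> V v^-1.
  by case=> Rv Nv; split; [apply: root_setV|case: sN => _ _; apply].
have VVM v w : V v -> V w -> V (v * w).
  move=> [Rv Nv] Vw; split; first by apply: VM => //; apply: NA.
  by case: Vw => _; case: sN => _ + _; apply.
have Vcomm a b : A a -> R H a -> A b -> R H (a ^ b) -> V [~ a, b].
  move=> Aa Ra Ab Rab; split; last exact: comN.
  rewrite commgEl; apply: (RK a) => //; last 1 first.
  - exact: root_setV.
  - by case: (sK a Aa) => _ _; apply.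
  rewrite conjg_commg; case: (sK a Aa) => _ KM _; apply: KM => //.
  by apply/NK/comN.
have Vh a h : A a -> R H a -> H h -> V [~ a, h].
  by move=> Aa Ra Hh; apply: Vcomm => //; [apply: HA|apply: root_setJ].
(* A power of a^b is a^m [a^m, b] with a^m in H, hence lies in R(H). *)
have Vab a b : A a -> A b -> R H a -> R H b -> V [~ a, b].
  move=> Aa Ab Ra Rb; apply: Vcomm => //; have [q pq Hq] := Ra.
  apply: (root_set_root pq); rewrite -conjXg conjg_commg; apply: VM.
  - exact: subgroupX.
  - exact: root_setX.
  - by rewrite -invgR; apply/VV/Vh.
have Vconj v a : A a -> R H a -> V v -> V (v ^ a).
  move=> Aa Ra Vv; rewrite conjg_commg; apply: (VVM) => //.
  by case: Vv => Rv Nv; apply: Vab => //; apply: NA.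
have pow m : exists2 v, V v & (x * y) ^+ m = x ^+ m * y ^+ m * v.
  elim: m => [|m [v Vv IHm]].
    exists 1; last by rewrite !expg0 !mulg1.
    by split; [exists 1%N => //=; case: sH|case: sN].
  have Ayv : A (y ^+ m * v).
    by apply: AM; [apply: subgroupX|apply: NA; case: Vv].
  have Ryv : R H (y ^+ m * v).
    by apply: VM => //; [apply: subgroupX|apply: root_setX].
  exists ((v * [~ y ^+ m * v, x]) ^ y).
    by apply: Vconj => //; apply: VVM => //; apply: Vab.
  have e := commgC (y ^+ m * v) x.
  rewrite expgSr IHm; transitivity (x ^+ m * (y ^+ m * v * x) * y).
    by rewrite !mulgA.
  by rewrite e !expgSr conjgE !mulgA mulgK.
have [m [pm Hx Hy]] := root_set_common sH Rx Ry.
apply: (root_set_root pm); have [v Vv ->] := pow m.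
have Hxy : H (x ^+ m * y ^+ m) by case: sH => _ HM _; apply: HM.
by apply: VM => //; [apply: HA|apply: sub_root_set].
Qed.

Lemma subgroup_root_set n s H : central_series [set: G] n s ->
  subgroup H -> subgroup (R H).
Proof.
move=> cs sH; split; first by apply: sub_root_set; case: sH.
- by move=> x y; apply: (root_set_mul cs).
- by move=> x; apply: root_setV.
Qed.

End Roots.

Section Isolated.
Variables (G : groupType) (pi : nat_pred).
Implicit Types (x y : G) (H K : set G).

Lemma isolated_root K x q : isolated pi K -> pi.-nat q -> K (x ^+ q) -> K x.
Proof.
move=> isoK; have [n] := ubnP q; elim: n q => // n IHn q /ltnSE qn pq.
have [q1|q1] := leqP q 1.
  have -> : q = 1%N by apply/eqP; rewrite eqn_leq q1; case/andP: pq.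
  by rewrite expg1.
have pr := pdiv_prime q1; have := pq; rewrite -{1}(divnK (pdiv_dvd q)) pnatM.
case/andP=> pq' ppr.
rewrite -(divnK (pdiv_dvd q)) expgnA => /isoK Kx.
apply: (IHn (q %/ pdiv q)) => //.
  by apply: leq_trans qn; rewrite ltn_Pdiv ?prime_gt1 // ltnW.
by apply: Kx => //; rewrite pnatE in ppr.
Qed.

Lemma isolated_root_set H : isolated pi (root_set pi H).
Proof.
by move=> x q q_pr pi_q; apply: root_set_root; rewrite pnatE.
Qed.

Lemma isolator_root_set H : subgroup (root_set pi H) ->
  isolator pi H = root_set pi H.
Proof.
move=> sR; apply/seteqP; split.
  apply: smallest_sub; last exact: sub_root_set.
  by split=> //; apply: isolated_root_set.
move=> x [q pq Hx] K [[sK isoK] HK].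
by apply: (isolated_root isoK pq); apply: HK.
Qed.

End Isolated.

(** * Nilpotency class of an isolator *)

(** If x^m = y^m then x and its conjugate x^y have the same m-th power and lie in
    a subgroup of smaller class, so they are equal by induction; then x and y
    commute and x / y is a torsion element. *)
Lemma root_unique (G : groupType) (pi : nat_pred) (A : set G) n s x y m :
  torsion_free G pi -> central_series A n s -> A x -> A y -> pi.-nat m ->
  x ^+ m = y ^+ m -> x = y.
Proof.
move=> tfG; elim: n A s x y => [|n IHn] A s x y cs Ax Ay pm exy.
  move: Ax Ay; rewrite -(cs_top cs); case: cs => -> _ _ _ /= -> ->; by [].
suff /commgP xy : [~ x, y] == 1.
  apply: divg1_eq; apply: (isolated_root tfG pm) => /=.
  by rewrite expgnFl // exy divgg.
case: n => [|n] in s cs IHn *.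
  have := cs_comm cs (ltn0Sn 0); rewrite (cs_top cs); case: cs => -> _ _ _ c.
  exact/eqP/c.
have sN : subgroup (s n.+1) by apply: (cs_subgroup cs).
apply/eqP; rewrite commgEl; suff -> : x ^ y = x by rewrite mulVg.
have Kx : join (s n.+1) (cyclic x) x.
  apply: join_subr (cyclic_id x) => //; last exact: subgroup_cyclic.
  by case: sN.
apply: (IHn _ _ _ _ (cs_join_cyclic cs Ax)) => //.
  rewrite conjg_commg; have [_ + _] := cs_group (cs_join_cyclic cs Ax); apply=> //.
  apply: join_subl; first by case: (subgroup_cyclic x).
  by apply: (cs_comm cs) => //; rewrite (cs_top cs).
by rewrite -conjXg exy conjXg conjgE mulgA mulVg mul1g.
Qed.

Section Transport.
Variables (G H : groupType) (f : {multiplicative G -> H}).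

Lemma subgroup_image A : subgroup A -> subgroup (f @` A).
Proof.
move=> [A1 AM AV]; split.
- by exists 1; rewrite ?hom1.
- by move=> _ _ [x Ax <-] [y Ay <-]; exists (x * y); rewrite ?homM //; apply: AM.
- by move=> _ [x Ax <-]; exists x^-1; rewrite ?homV //; apply: AV.
Qed.

Lemma subgroup_preimage B : subgroup B -> subgroup (f @^-1` B).
Proof.
move=> [B1 BM BV]; split=> [|x y|x] /=; first by rewrite hom1.
  by rewrite homM; apply: BM.
by rewrite homV; apply: BV.
Qed.

Lemma cs_image A n s : central_series A n s ->
  central_series (f @` A) n (fun i => f @` s i).
Proof.
move=> cs; split.
- by case: cs => -> _ _ _; rewrite image_set1 hom1.
- by rewrite (cs_top cs).
- by move=> i i_n; apply: subgroup_image; apply: (cs_subgroup cs).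
- move=> i i_n; split; first by apply: image_subset; apply: (cs_subS cs).
  move=> _ _ [x sx <-] [y Ay <-]; exists [~ x, y]; last exact: homR.
  exact: (cs_comm cs).
Qed.

Lemma cs_preimage B n s : injective f -> central_series B n s ->
  central_series (f @^-1` B) n (fun i => f @^-1` s i).
Proof.
move=> fI cs; split.
- case: cs => -> _ _ _; apply/seteqP; split=> x /=; last by move=> ->; rewrite hom1.
  by move=> fx; apply: fI; rewrite hom1.
- by rewrite (cs_top cs).
- by move=> i i_n; apply: subgroup_preimage; apply: (cs_subgroup cs).
- move=> i i_n; split; first by move=> x; apply: (cs_subS cs).
  by move=> x y /= sx By; rewrite homR; apply: (cs_comm cs).
Qed.

End Transport.

Definition center (G : groupType) : set G := [set z | forall g, commute z g].

Lemma normal_center (G : groupType) : normal (@center G).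
Proof.
split; first split=> [g|x y Zx Zy g|x Zx g].
- exact/commute_sym/commute1.
- by apply/commute_sym/commuteM; apply/commute_sym.
- by apply/commute_sym/commuteV/commute_sym.
by move=> x y Zx g; rewrite conjgE (Zx y) mulKg.
Qed.

(** The first term of a central series of [H] commutes with the roots of elements
    of [H], by uniqueness of roots, and so is central in [G]; the quotient by the
    centre shortens the series of the image of [H]. *)
Lemma root_class_bound c (G : groupType) (pi : nat_pred) n s (H : set G) t :
  torsion_free G pi -> central_series [set: G] n s -> subgroup H ->
  (forall x, root_set pi H x) -> central_series H c t ->
  exists r, central_series [set: G] c r.
Proof.
elim: c G n s H t => [|c IHc] G n s H t tfG cs sH RH ct.
  exists (fun=> [set 1]); split=> //; last by move=> i _; apply: subgroup1.
  apply/esym/seteqP; split=> // x _; have [q pq] := RH x.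
  rewrite -(cs_top ct); case: ct => -> _ _ _ xq; exact: (isolated_root tfG pq).
have uniq (x y : G) q : pi.-nat q -> x ^+ q = y ^+ q -> x = y.
  by move=> pq; apply: (root_unique tfG cs).
have fixJ (x y : G) q : pi.-nat q -> commute (x ^+ q) y -> commute x y.
  move=> pq xy; apply/commgP; rewrite -conjg_fix; apply/eqP/(uniq _ _ q) => //.
  by rewrite -conjXg; apply/conjg_fixP/commgP.
have [Q [f [fT kerf]]] := quotient_exists (@normal_center G).
have fS u : exists x, f x = u.
  by have : range f u by [rewrite fT]; case=> x _ <-; exists x.
have tfQ : torsion_free Q pi.
  move=> u q q_pr pq; have [x <-] := fS u; rewrite /= -homX => /kerf Zx.
  by apply/kerf => g; apply: (fixJ _ _ q) => //; rewrite pnatE.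
have csQ := cs_image f cs; rewrite fT in csQ.
have [r cr] : exists r, central_series [set: Q] c r.
  apply: (IHc _ _ _ (f @` H) (fun i => f @` t i.+1) tfQ csQ).
  - exact: subgroup_image.
  - move=> u; have [x <-] := fS u; have [q pq Hx] := RH x.
    by exists q => //; exists (x ^+ q) => //; apply: homX.
  have cf := cs_image f ct; split.
  - apply/seteqP; split=> [_ [z tz <-]|_ ->]; last first.
      by exists 1; rewrite ?hom1 //; case: (cs_subgroup ct (ltn0Sn c)).
    apply/kerf => g; have [q pq Hg] := RH g; apply/commute_sym/(fixJ _ _ q) => //.
    apply/commute_sym/commgP/eqP; have := cs_comm ct (ltn0Sn c) tz Hg.
    by case: ct => -> _ _ _.
  - by rewrite (cs_top ct).
  - by move=> i i_c; apply: (cs_subgroup cf).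
  - by move=> i i_c; case: cf => _ _ _ H'; apply: H'.
exists (fun i => if i is j.+1 then f @^-1` r j else [set 1]); split=> //.
- by rewrite (cs_top cr).
- case=> [|i] i_c; last by apply: subgroup_preimage; apply: (cs_subgroup cr).
  exact: subgroup1.
- case=> [|i] i_c; split.
  + by move=> x -> /=; rewrite hom1; case: (cs_subgroup cr (leq0n c)).
  + move=> x y; case: cr => /= -> _ _ _ /kerf Zx _; exact/eqP/commgP.
  + by move=> x; apply: (cs_subS cr).
  + by move=> x y /= rx _; rewrite homR; apply: (cs_comm cr).
Qed.

Lemma nil_class_root_set (G : groupType) (pi : nat_pred) n s (Y : set G) :
  central_series [set: G] n s -> torsion_free G pi -> subgroup Y ->
  exists2 c, has_nil_class Y c & has_nil_class (root_set pi Y) c.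
Proof.
move=> cs tfG sY; set I := root_set pi Y.
have sI : subgroup I by apply: (subgroup_root_set pi cs).
have YI : Y `<=` I := @sub_root_set _ pi Y.
have exY : exists c, `[< exists t, central_series Y c t >].
  by exists n; apply/asboolP; eexists; apply: (cs_restrict cs).
have [c /asboolP[t ct] cmin] := ex_minnP exY.
have cminY m r : central_series Y m r -> (c <= m)%N.
  by move=> cr; apply: cmin; apply/asboolP; exists r.
exists c; split=> //; first by exists t.
  pose v := subg_val sI; have vI : injective v := @subg_val_inj _ _ sI.
  have csI := cs_preimage vI (cs_restrict cs sI (@subsetT _ _)).
  have vT : v @^-1` I = setT by apply/seteqP; split=> // x _; apply: subg_valP.
  rewrite vT in csI.
  have [] := @root_class_bound c _ pi n _ (v @^-1` Y) _ _ csI _ _ (cs_preimage vI ct).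
  - move=> x q q_pr pq xq; apply: vI; rewrite hom1.
    by apply: (tfG _ q q_pr pq); rewrite -homX xq; apply: hom1.
  - exact: subgroup_preimage.
  - move=> x; have [q pq Yq] := subg_valP x.
    by rewrite -homX in Yq; exists q.
  - move=> r cr; exists (fun i => v @` r i).
    by have := cs_image v cr; rewrite range_subg_val.
by move=> m r cr; apply: cminY; apply: (cs_restrict cr).
Qed.

(** * Orders of elements and maximal subgroups *)

Section Orders.
Variable G : groupType.
Implicit Types (x y a b : G) (H K L M Y : set G).

Lemma has_order_exists x n : (0 < n)%N -> x ^+ n = 1 -> exists m, has_order x m.
Proof.
move=> n0 xn; have exP : exists m, (0 < m)%N && (x ^+ m == 1).
  by exists n; rewrite n0 xn eqxx.
have [m /andP[m0 /eqP xm] mmin] := ex_minnP exP.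
exists m; split=> // k /andP[k0 km] xk.
by have := mmin k; rewrite k0 xk eqxx leqNgt km => /(_ isT).
Qed.

Lemma has_order_dvd x m n : has_order x m -> x ^+ n = 1 -> m %| n.
Proof.
case=> m0 xm xmin; rewrite {1}(divn_eq n m) expgnDr mulnC expgnA xm expg1n mul1g.
move=> xr; rewrite /dvdn; case: posnP => // r0; exfalso.
by apply: xmin xr; rewrite r0 ltn_mod.
Qed.

Lemma p_power_order p k x : prime p -> x ^+ (p ^ k) = 1 ->
  primary_component G p x.
Proof.
move=> p_pr xk; have pk0 : (0 < p ^ k)%N by rewrite expn_gt0 prime_gt0.
have [m om] := has_order_exists pk0 xk.
have /(dvdn_pfactor _ _ p_pr)[j _ e] := has_order_dvd om xk.
by exists j; rewrite -e.
Qed.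

(** Bezout. *)
Lemma coprime_power_mem M a p t : subgroup M -> (0 < p)%N -> coprime p t ->
  M (a ^+ p) -> M (a ^+ t) -> M a.
Proof.
move=> sM p0 /eqP cpt Mp Mt; case: (egcdnP t p0) => u v e _.
have : M (a ^+ (u * p)) by rewrite mulnC expgnA; apply: subgroupX.
rewrite e cpt expgnDr expg1; apply: (proj1 (subgroupMl _ sM _)).
by rewrite mulnC expgnA; apply: subgroupX.
Qed.

Lemma maximal_avoiding Y x : subgroup Y -> ~ Y x -> exists M,
  [/\ subgroup M, Y `<=` M, ~ M x &
      forall L, subgroup L -> M `<=` L -> ~ L x -> L `<=` M].
Proof.
move=> sY Yx.
(* The union of the empty chain is empty; adding Y makes it admissible. *)
pose P (A : set G) := subgroup (A `|` Y) /\ ~ (A `|` Y) x.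
have [] := @Zorn_bigcup G P; last first.
  move=> A [[sAY AYx] Amax]; exists (A `|` Y); split=> //.
  move=> L sL AYL Lx g Lg; apply: contrapT => nAYg.
  have LY : L `|` Y = L.
    by apply/setUidl; apply: subset_trans AYL; apply: subsetUr.
  apply: (Amax L); last by rewrite /P LY.
  split; last by move=> LA; apply: nAYg; left; apply: LA.
  by apply: subset_trans AYL; apply: subsetUl.
move=> F FP Ftot; have [Y1 YM YV] := sY.
set U := \bigcup_(A in F) A.
have UP g : (U `|` Y) g -> Y g \/ exists2 A, F A & (A `|` Y) g.
  by case=> [[A FA Ag]|]; [right; exists A => //; left|left].
have UI A g : F A -> (A `|` Y) g -> (U `|` Y) g.
  by move=> FA [Ag|]; [left; exists A|right].
split; last first.
  by case/UP => // -[A FA Ax]; case: (FP _ FA).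
split; first by right.
- move=> g h /UP Ug /UP Uh.
  have [[A FA [Ag Ah]]|[Yg Yh]] :
      (exists2 A, F A & (A `|` Y) g /\ (A `|` Y) h) \/ (Y g /\ Y h).
    case: Ug Uh => [Yg|[A FA Ag]] [Yh|[B FB Bh]]; first by right.
    - by left; exists B => //; split=> //; right.
    - by left; exists A => //; split=> //; right.
    left; have [AB|BA] := Ftot A B FA FB.
      by exists B => //; split=> //; apply: setSU Ag.
    by exists A => //; split=> //; apply: setSU Bh.
  + by apply: (UI _ _ FA); case: (FP _ FA) => -[_ AM _] _; apply: AM.
  + by right; apply: YM.
- move=> g /UP [Yg|[A FA Ag]]; first by right; apply: YV.
  by apply: (UI _ _ FA); case: (FP _ FA) => -[_ _ AV] _; apply: AV.
Qed.

End Orders.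

(** * Abelian groups of prime power exponent in a root class *)

(** A subgroup M maximal among those avoiding [a] is complemented by <a>, because
    a maximal subgroup avoiding [a] gains [a] as soon as it gains any element.
    The character kills M and sends a to e. *)
Lemma exists_character (A E : groupType) p (a : A) (e : E) :
  prime p -> (forall x y : A, commute x y) -> (forall x : A, x ^+ p = 1) ->
  has_order e p -> a <> 1 -> exists f : {multiplicative A -> E}, f a <> 1.
Proof.
move=> p_pr cA expA [_ ep emin] a1; have p0 := prime_gt0 p_pr.
have [M [sM _ Ma Mmax]] := maximal_avoiding (@subgroup1 A) a1.
have [M1 MM MV] := sM.
have Mt t : M (a ^+ t) -> p %| t.
  move=> Mt; apply: contrapT => /negP; rewrite -prime_coprime // => cpt.
  by apply/Ma/(coprime_power_mem sM p0 cpt) => //; rewrite expA.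
(* If b is outside M, then a b^k lies in M for some k, necessarily prime to p;
   raising to the inverse u of k modulo p gives b a^u. *)
have exM b : exists i, M (b * a ^+ i).
  apply: contrapT => nM.
  have Mb : ~ M b by move=> Mb; apply: nM; exists 0%N; rewrite expg0 mulg1.
  have nMb : cyclic b `<=` normalizer M.
    by move=> g _ w; rewrite conjgE (cA w) mulKg.
  have sL := subgroup_join sM (subgroup_cyclic b) nMb.
  have [c10 _ _] := subgroup_cyclic b.
  have [_ [x [y ->]]] : join M (cyclic b) a.
    apply: contrapT => La; apply/Mb/(Mmax _ sL) => //; first exact: join_subl.
    by apply: join_subr (cyclic_id b) => //; apply: subgroup_cyclic.
  have -> : b ^- y = b ^+ (p.-1 * y).
    apply: mulg1_eq; rewrite -expgnDr -[X in (X + _)%N]mul1n -mulnDl add1n.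
    by rewrite prednK // expgnA expA expg1n.
  rewrite -expgnDr; move: (_ + _)%N => k Mk.
  have ck : coprime k p.
    rewrite coprime_sym prime_coprime //; apply/negP => /dvdnP[q kq].
    by apply: Ma; move: Mk; rewrite kq mulnC expgnA expA expg1n mulg1.
  have k0 : (0 < k)%N.
    by case: (k) ck => //; rewrite /coprime gcd0n => /eqP pe; rewrite pe in p_pr.
  case: (egcdnP p k0) => u v e' _; apply: nM; exists u.
  move: e'; rewrite (eqP ck) => e'.
  have := subgroupX u sM Mk; rewrite expgMn // -expgnA (mulnC k) e' expgnDr.
  by rewrite mulnC expgnA expA expg1n mul1g expg1 cA.
have uniM b i j : M (b * a ^+ i) -> M (b * a ^+ j) -> e ^+ i = e ^+ j.
  wlog ij : i j / (i <= j)%N => [W Mi Mj|].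
    by case/orP: (leq_total i j) => ij; [|apply/esym]; apply: W.
  move=> Mi Mj; have : M (a ^+ (j - i)).
    have := MM _ _ (MV _ Mi) Mj; rewrite invgM -mulgA mulKg.
    by rewrite -{1}(subnKC ij) expgnDr mulKg.
  move/Mt/dvdnP=> [q qe]; rewrite -(subnKC ij) expgnDr qe mulnC expgnA ep.
  by rewrite expg1n mulg1.
have [i iM] := choice exM.
have fM : {morph (fun b => e ^- i b) : b c / b * c}.
  move=> b c; rewrite -invgM -expgnDr; congr (_^-1).
  apply: (uniM (b * c)) (iM _) _; rewrite addnC expgnDr.
  have -> : b * c * (a ^+ i b * a ^+ i c) = (b * a ^+ i b) * (c * a ^+ i c).
    by rewrite !mulgA -[b * c * _]mulgA (cA c) !mulgA.
  exact: MM.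
exists (hom_of fM) => /= fa.
have /dvdnP[q qi] : p %| i a.
  apply: (@has_order_dvd _ e) => //.
  by rewrite -[e ^+ _]invgK fa invg1.
by apply: Ma; have := iM a; rewrite qi mulnC expgnA expA expg1n mulg1.
Qed.

Section RootClass.
Variables (C : groupType -> Prop) (C_root : root_class C).

Lemma root_trivial (G : groupType) : (forall x : G, x = 1) -> C G.
Proof.
move=> G1; have [E CE _] := root_nontrivial C_root.
have fM : {morph (fun _ : G => 1 : E) : x y / x * y} by move=> x y; rewrite mulg1.
apply: (@root_subgroup _ C_root E G (hom_of fM)) CE.
by move=> x y _; rewrite (G1 x) (G1 y).
Qed.

Lemma root_ext (G Q : groupType) (f : {multiplicative G -> Q}) K
    (sK : subgroup K) : range f = [set: Q] -> (forall x, f x = 1 <-> K x) ->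
  C (subg_type sK) -> C Q -> C G.
Proof.
move=> fT fK; apply: (root_extension C_root (@subg_val_inj _ _ sK) fT).
by rewrite range_subg_val; apply/seteqP; split=> x /fK.
Qed.

(** The characters of [A] separate its points; as one is needed for each element
    of [A], they can be indexed by [D], and they embed [A] in a Cartesian power
    of [E] that the axioms of a root class allow. *)
Lemma root_elementary_abelian (A D E : groupType) p (e : E) (g : A -> D) :
  C D -> C E -> has_order e p -> injective g -> prime p ->
  (forall x y : A, commute x y) -> (forall x : A, x ^+ p = 1) -> C A.
Proof.
move=> CD CE oe gI p_pr cA expA.
have : forall d : D, exists f : {multiplicative A -> E},
    forall a, g a = d -> a <> 1 -> f a <> 1.
  move=> d; have [[a [ga a1]]|nd] := pselect (exists a, g a = d /\ a <> 1).
    have [f fa] := exists_character p_pr cA expA oe a1.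
    by exists f => b; rewrite -ga => /gI ->.
  have fM : {morph (fun _ : A => 1 : E) : x y / x * y} by move=> x y; rewrite mulg1.
  by exists (hom_of fM) => a ga a1; case: nd; exists a.
move=> /choice[f fP].
have FM : {morph (fun a => (fun d => f d a) : cart_prod (fun _ : D => E)) : x y / x * y}.
  by move=> x y; apply: functional_extensionality_dep => d; apply: homM.
apply: (root_subgroup C_root (f := hom_of FM)).
  apply: hom_inj => a Fa; apply: contrapT => a1.
  by apply: (fP (g a) a) => //; have := congr1 (fun h => h (g a)) Fa.
apply: (root_cart_prod C_root CE CD) => d.
have iM : {morph (fun x : E => x) : x y / x * y} by [].
by exists (hom_of iM); exists id.
Qed.

(** Raising to the power p exhibits [A] as an extension of a group of exponent
    p by one of exponent p^(k-1). *)
Lemma root_abelian (A D E : groupType) p k (e : E) (g : A -> D) :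
  C D -> C E -> has_order e p -> injective g -> prime p ->
  (forall x y : A, commute x y) -> (forall x : A, x ^+ (p ^ k) = 1) -> C A.
Proof.
move=> CD CE oe + p_pr; elim: k A g => [|k IHk] A g gI cA expA.
  by apply: root_trivial => x; rewrite -[x]expg1 -(expn0 p).
have qM : {morph (fun x : A => x ^+ p) : x y / x * y} by move=> x y; apply: expgMn.
pose q := hom_of qM.
have sI : subgroup (range q) by apply: subgroup_image.
have rM : {morph (fun x => subg_in sI (imageT q x)) : x y / x * y}.
  by move=> x y; apply: subg_val_inj; rewrite [RHS]homM; apply: (homM q).
have sK : subgroup [set x | q x = 1] by exact: (subgroup_preimage q (@subgroup1 A)).
apply: (@root_ext A _ (hom_of rM) _ sK).
- apply/seteqP; split=> // u _; have [x _ qx] := subg_valP u.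
  by exists x => //; apply: subg_val_inj; rewrite -qx.
- move=> x; split=> [/(congr1 (subg_val sI))|]; first by rewrite hom1.
  by move=> qx; apply: subg_val_inj; rewrite hom1.
- apply: (root_elementary_abelian (g := g \o subg_val sK) CD CE oe) => //.
  + exact: inj_comp gI (@subg_val_inj _ _ sK).
  + by move=> x y; apply: subg_val_inj; rewrite !homM cA.
  + by move=> x; apply: subg_val_inj; rewrite homX hom1; apply: (subg_valP x).
- apply: (IHk _ (g \o subg_val sI)).
  + exact: inj_comp gI (@subg_val_inj _ _ sI).
  + by move=> x y; apply: subg_val_inj; rewrite !homM cA.
  + move=> x; apply: subg_val_inj; rewrite homX hom1; have [y _ <-] := subg_valP x.
    by rewrite /= -expgnA -expnS.
Qed.

Lemma primes_of_order p : p \in primes_of C ->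
  exists (E : groupType) (e : E), C E /\ has_order e p.
Proof.
rewrite inE => /andP[p_pr /asboolP[E [x [n [CE ox pn]]]]].
exists E, (x ^+ (n %/ p)); split=> //; have [n0 xn xmin] := ox.
split; [exact: prime_gt0|by rewrite -expgnA divnK|].
move=> m /andP[m0 mp]; rewrite -expgnA; apply: xmin.
rewrite muln_gt0 m0 divn_gt0 ?prime_gt0 // dvdn_leq //=.
by rewrite -[X in (_ < X)%N](divnK pn) ltn_pmul2l // divn_gt0 ?prime_gt0 // dvdn_leq.
Qed.

(** * Quotients of bounded nilpotent groups *)

(** Downward induction on i: if f kills s_i, then f(s_(i+1)) is central in Q and
    is an image of the bounded group s_(i+1) / s_i, while the quotient of Q by it
    is an image of X that kills s_(i+1). *)
Lemma root_quotient (X : groupType) n s p k i (Q : groupType)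
    (f : {multiplicative X -> Q}) :
  central_series [set: X] n s ->
  (forall i, (i < n)%N ->
    exists2 B : groupType, is_quotient (s i.+1) (s i) B & bounded_abelian C B) ->
  p \in primes_of C -> (i <= n)%N -> range f = [set: Q] ->
  (forall u : Q, u ^+ (p ^ k) = 1) -> (forall x, s i x -> f x = 1) -> C Q.
Proof.
move=> cs bd pC i_n; have p_pr : prime p by move: pC; rewrite inE => /andP[].
rewrite -(subKn i_n); elim: (n - i)%N (leq_subr i n) Q f => [|m IHm] mn Q f fT expQ fs.
  apply: root_trivial => u; have [x _ <-] : range f u by rewrite fT.
  by apply: fs; rewrite subn0 (cs_top cs).
set j := (n - m.+1)%N in fs; have jn : (j < n)%N by rewrite ltn_subrL (leq_trans _ mn).
have ej : (n - m)%N = j.+1 by rewrite /j subnSK.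
rewrite ej in IHm.
have fS u : exists x, f x = u.
  by have : range f u by [rewrite fT]; case=> x _ <-; exists x.
have sj : subgroup (s j.+1) by apply: (cs_subgroup cs).
have sK : subgroup (f @` s j.+1) by apply: subgroup_image.
have nK : normal (f @` s j.+1).
  split=> // _ u [x sx <-]; have [y <-] := fS u; rewrite -homJ.
  by exists (x ^ y) => //; apply: (cs_conj cs jn sx).
have [Q' [h [hT hK]]] := quotient_exists nK.
have hfM : {morph (h \o f) : x y / x * y} by move=> x y /=; rewrite !homM.
have CQ' : C Q'.
  apply: (IHm (ltnW mn) _ (hom_of hfM)).
  - apply/seteqP; split=> // v _; have [u _ <-] : range h v by rewrite hT.
    by have [x <-] := fS u; exists x.
  - move=> v; have [u _ <-] : range h v by rewrite hT.
    by rewrite -homX expQ hom1.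
  - by move=> x sx; apply/hK; exists x.
apply: (root_ext (sK := sK) hT hK) CQ'.
have [B [q [qM qT qK]] [cB /(_ (subg_type sK))bB]] := bd j jn.
have qS b : exists x, s j.+1 x /\ q x = b.
  have : [set: B] b by exact: Logic.I.
  by rewrite -qT => -[x]; exists x.
have [r rP] := choice qS.
(* f factors through q on s_(j+1); t is the induced map. *)
have q_f x y : s j.+1 x -> s j.+1 y -> q x = q y -> f x = f y.
  move=> sx sy qxy; have [_ sM sV] := sj.
  have sxV : s j.+1 x^-1 by apply: sV.
  have q1 : q 1 = 1.
    have s1 : s j.+1 1 by case: sj.
    by apply: (mulgI (q 1)); rewrite -qM // !mulg1.
  have : s j (x^-1 * y).
    rewrite -qK; split; first exact: sM.
    by rewrite qM // -qxy -qM // mulVg.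
  by move/fs; rewrite homM homV => /mulg1_eq; rewrite invgK.
pose t b : subg_type sK := subg_in sK (imageP f (rP b).1).
have tM : {morph t : b c / b * c}.
  move=> b c; apply: subg_val_inj; rewrite homM !subg_inK -homM.
  have [sb qb] := rP b; have [sc qc] := rP c; have [sbc qbc] := rP (b * c).
  by apply: q_f => //; [case: sj => _ sM _; apply: sM|rewrite qM // qb qc].
have tT : range (hom_of tM) = setT.
  apply/seteqP; split=> // u _; have [x sx fx] := subg_valP u.
  exists (q x) => //; apply: subg_val_inj; rewrite -fx.
  by apply: q_f => //; case: (rP (q x)).
have cK (u v : subg_type sK) : commute u v.
  have [b _ <-] : range (hom_of tM) u by rewrite tT.
  have [c _ <-] : range (hom_of tM) v by rewrite tT.
  exact/gmulf_commute.
have expK (u : subg_type sK) : u ^+ (p ^ k) = 1.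
  by apply: subg_val_inj; rewrite homX hom1.
have [_ [D CD]] := bB (hom_of tM) tT p pC.
have -> : primary_component (subg_type sK) p = setT.
  by apply/seteqP; split=> // u _; apply: p_power_order (expK u).
case/card_leP => g.
have [E [e [CE oe]]] := primes_of_order pC.
pose g' (u : subg_type sK) : D := val (g (exist _ u (mem_set (Logic.I : setT u)))).
apply: (root_abelian (g := g') CD CE oe _ p_pr cK expK) => u v.
by move=> /val_inj /inj e'; apply: (congr1 val (e' _ _)); rewrite in_setT.
Qed.

End RootClass.

(** * Separation of isolated subgroups *)

Lemma commgX_central (G : groupType) (x y : G) t :
  (forall g, commute [~ x, y] g) -> [~ x, y ^+ t] = [~ x, y] ^+ t.
Proof.
move=> c; suff e : x ^ (y ^+ t) = x * [~ x, y] ^+ t by rewrite commgEl e mulKg.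
elim: t => [|t IHt]; first by rewrite !expg0 conjg1 mulg1.
rewrite expgSr conjgM IHt conjMg [x ^ y]conjg_commg -mulgA expgS; congr (_ * (_ * _)).
by rewrite conjXg conjgE c mulKg.
Qed.

Section NormalSubgroups.
Variable G : groupType.
Implicit Types (M N K S W : set G).

Lemma normal_join W S : normal W -> normal S -> normal (join W S).
Proof.
move=> [sW WJ] [sS SJ]; split.
  apply: subgroup_join => //; apply: subset_trans (@subsetT _ _) _.
  by apply: sub_normalizer (@subgroupT G) _ => w a Ww _; apply: WJ.
move=> x y [t St Wxt]; exists (t ^ y); first exact: SJ.
by rewrite -conjMg; apply: WJ.
Qed.

(** The largest normal subgroup inside [M]. *)
Definition core M : set G := [set g | forall a, M (g ^ a)].

Lemma normal_core M : subgroup M -> normal (core M).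
Proof.
move=> [M1 MM MV]; split; last by move=> x y Cx a; rewrite -conjgM.
split=> [a|x y Cx Cy a|x Cx a]; first by rewrite conj1g.
  by rewrite conjMg; apply: MM.
by rewrite conjVg; apply: MV.
Qed.

Lemma core_sub M : core M `<=` M.
Proof. by move=> g /(_ 1); rewrite conjg1. Qed.

(** When [v, g] lies in K_(i+1), it is central modulo K_i and the map
    t |-> [v, g^t] is a morphism modulo K_i; so raising g to the power q moves its
    commutators one step down. *)
Lemma comm_power_descent (K : nat -> set G) j q g :
  (forall i, (i <= j)%N -> normal (K i)) ->
  (forall i, (i < j)%N -> K i `<=` K i.+1) ->
  (forall i x y, (i < j)%N -> K i.+1 x -> K i [~ x, y]) ->
  (forall c, K j c -> K 0%N (c ^+ q)) -> (forall v, K j [~ v, g]) ->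
  forall v, K 0%N [~ v, g ^+ (q ^ j)].
Proof.
elim: j g => [|j IHj] g nK subK cK powK Kg; first by rewrite expn0 expg1.
rewrite expnS expgnA; apply: IHj => [i i_j|i i_j|i x y i_j|c Kc|v].
- by apply: nK; rewrite leqW.
- by apply: subK; rewrite leqW.
- by apply: cK; rewrite leqW.
- by apply/powK/subK.
have [Q [f [fT fK]]] := quotient_exists (nK j (leqnSn j)).
have K0j i : (i <= j)%N -> K 0%N `<=` K i.
  elim: i => [_|i IHi i_j]; first exact: subset_refl.
  by apply: subset_trans (IHi (ltnW i_j)) (subK _ _); rewrite leqW.
have cQ u : commute [~ f v, f g] u.
  have [y _ <-] : range f u by rewrite fT.
  by apply/commgP/eqP; rewrite -!homR; apply/fK/cK.
apply/fK; rewrite homR homX commgX_central // -homR -homX.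
by apply/fK/(K0j j)/powK.
Qed.

End NormalSubgroups.

Section Separation.
Variables (X : groupType) (n : nat) (s : nat -> set X).
Hypothesis cs : central_series [set: X] n s.
Implicit Types (M Y : set X).

Lemma cs_normal i : (i <= n)%N -> normal (s i).
Proof.
move=> i_n; split; first exact: (cs_subgroup cs).
by move=> x y sx; apply: (cs_conj cs).
Qed.

(** For w in s_i, central modulo s_(i-1), one has (m w)^q = m^q w^q w' with w' in
    s_(i-1), and m^q w^q lies in M again. *)
Lemma power_coset_descent M j q : subgroup M -> (j <= n)%N ->
  (forall w, s j w -> M (w ^+ q)) ->
  forall i m w, (i <= j)%N -> M m -> s i w -> M ((m * w) ^+ (q ^ i)).
Proof.
move=> sM j_n pow; have [_ MM _] := sM.
elim=> [|i IHi] m w i_j Mm sw.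
  by move: sw; case: cs => -> _ _ _ ->; rewrite expn0 mulg1.
have i_n : (i < n)%N by apply: leq_trans j_n.
have [Q [f [fT fK]]] := quotient_exists (cs_normal (ltnW i_n)).
have mw : commute (f m) (f w).
  by apply/commgP/eqP; rewrite -homR; apply/fK/(cs_comm' cs).
pose m' := m ^+ q * w ^+ q.
have Mm' : M m'.
  apply: MM; first exact: subgroupX.
  by apply: pow; apply: (cs_sub cs _ sw); rewrite i_j.
rewrite expnS expgnA -[_ ^+ q](mulVKg m'); apply: IHi => //; first exact: ltnW.
by apply/fK; rewrite homM homV !homX !homM !homX expgMn // mulVg.
Qed.

Section MaximalAvoiding.
Variables (p : nat) (M : set X) (x : X).
Hypotheses (p_pr : prime p) (sM : subgroup M) (Mx : ~ M x) (Mxp : M (x ^+ p)).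
Hypothesis Mmax : forall L, subgroup L -> M `<=` L -> ~ L x -> L `<=` M.

(** The roots of M of order prime to p form a subgroup; it avoids x because x^p
    lies in M. *)
Lemma maximal_isolated y r : coprime p r -> M (y ^+ r) -> M y.
Proof.
move=> cpr Myr.
have r0 : (0 < r)%N.
  by case: (r) cpr => //; rewrite /coprime gcdn0 => /eqP e; have := p_pr; rewrite e.
suff : root_set p^' M `<=` M.
  by apply; exists r => //; rewrite p'natE // -prime_coprime.
apply: Mmax; [exact: (subgroup_root_set _ cs)|exact: sub_root_set|].
move=> [t pt Mxt]; apply/Mx/(coprime_power_mem sM (prime_gt0 p_pr) _ Mxp Mxt).
by rewrite prime_coprime // -p'natE //; case/andP: pt.
Qed.

(** The hypothesis makes h central modulo the core of M, so it normalises M.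
    If h is outside M, then x = m h^c with c nonzero, and x^p in M gives a
    nonzero power of h in M, whose exponent loses its factors other than p by
    [maximal_isolated]. *)
Lemma maximal_power_normalizing h : (forall v, core M [~ v, h]) ->
  exists u, M (h ^+ (p ^ u)).
Proof.
move=> Ch; have [Mh|Mh] := pselect (M h); first by exists 0%N; rewrite expn0.
have nh : normalizer M h.
  by move=> w; rewrite conjg_commg; apply: subgroupMr => //; apply: core_sub.
have nMh := cyclic_min (subgroup_normalizer M) nh.
have [M1 MM MV] := sM.
have [_ [a [b ->]] Mt] : join M (cyclic h) x.
  apply: contrapT => Lx; apply/Mh/(Mmax _ _ Lx).
  - by apply: subgroup_join => //; apply: subgroup_cyclic.
  - by apply: join_subl; case: (subgroup_cyclic h).
  - by apply: join_subr (cyclic_id h) => //; apply: subgroup_cyclic.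
have ab : a != b.
  by apply/eqP => ab; move: Mt; rewrite ab mulgV mulg1.
have [Q [f [_ fK]]] := quotient_exists (normal_core sM).
have ch v : commute (f v) (f h) by apply/commgP/eqP; rewrite -homR; apply/fK.
have Mtp : M (h ^+ (a * p) * h ^- (b * p)).
  rewrite 2!expgnA -expgnFl; last exact: commuteX2.
  move: Mt; set t := _ * h ^- b => Mt.
  have xt : commute (f x) (f t).
    by rewrite homM homV !homX; apply: commuteM; [|apply: commuteV]; apply: commuteX.
  clearbody t; have eC : core M ((x ^+ p * t ^+ p)^-1 * (x * t) ^+ p).
    by apply/fK; rewrite homM homV homX !homM !homX expgMn // mulVg.
  have := subgroupX p sM Mt; rewrite -[X in M X](mulVKg (x ^+ p * t ^+ p)).
  by move/(subgroupMr _ sM (core_sub eC))/(subgroupMl _ sM Mxp).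
have [|t t0 Mht] := cyclic_pow sM Mtp.
  by rewrite eqn_pmul2r ?prime_gt0.
have [r pr te] := pfactor_coprime p_pr t0.
exists (logn p t); apply: (maximal_isolated pr).
by rewrite -expgnA mulnC -te.
Qed.

Section Bounded.
Variable C : groupType -> Prop.
Hypothesis pC : p \in primes_of C.
Hypothesis bounded : forall i, (i < n)%N ->
  exists2 B : groupType, is_quotient (s i.+1) (s i) B & bounded_abelian C B.

(** Modulo M, the factor s_(j+1) / s_j becomes a p-group, and is a quotient of a
    bounded abelian group; so it has finite exponent. *)
Lemma bounded_power j : (j < n)%N ->
  (forall g, s j.+1 g -> exists u, M (g ^+ (p ^ u))) ->
  exists e, forall g, s j.+1 g ->
    exists m w, [/\ M m, s j w & g ^+ (p ^ e) = m * w].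
Proof.
move=> jn tor; have [Q [f [fM fT fK]] [cQ bQ]] := bounded jn.
have sj : subgroup (s j.+1) by apply: (cs_subgroup cs).
have [s1 sMul sV] := sj.
have f1 : f 1 = 1 by apply: (mulgI (f 1)); rewrite -fM // !mulg1.
have fV g : s j.+1 g -> f g^-1 = (f g)^-1.
  by move=> sg; apply/esym/mulg1_eq; rewrite -fM ?mulgV //; apply: sV.
have fX g k : s j.+1 g -> f (g ^+ k) = f g ^+ k.
  move=> sg; elim: k => [|k IHk]; first by rewrite !expg0.
  by rewrite !expgS fM ?IHk //; apply: subgroupX.
pose L := f @` (M `&` s j.+1).
have [M1 MM MV] := sM.
have nL : normal L.
  split; last by move=> u v Lu; rewrite conjgE (cQ u) mulKg.
  split; first by exists 1.
    move=> _ _ [a [Ma sa] <-] [b [Mb sb] <-]; exists (a * b); last exact: fM.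
    by split; [apply: MM|apply: sMul].
  move=> _ [a [Ma sa] <-]; exists a^-1; last exact: fV.
  by split; [apply: MV|apply: sV].
have [B [h [hT hK]]] := quotient_exists nL.
have [[e e0 Be] _] := bQ B h hT p pC.
exists e => g sg; have [u Mu] := tor g sg.
have hu : (h (f g)) ^+ (p ^ u) = 1.
  rewrite -homX -fX //; apply/hK; exists (g ^+ (p ^ u)) => //.
  by split=> //; apply: subgroupX.
have [v ov] := p_power_order p_pr hu.
(* e is an arbitrary exponent of the p-component; p^e is one too, as the order
   p^v divides e, whence v < p^v <= e. *)
have ve : (v <= e)%N.
  have := has_order_dvd ov (Be _ (p_power_order p_pr hu)) => /(dvdn_leq e0).
  by apply: leq_trans; apply/ltnW/ltn_expl/prime_gt1.
have : h (f g) ^+ (p ^ e) = 1.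
  by rewrite -(subnKC ve) expnD expgnA; case: ov => _ -> _; rewrite expg1n.
rewrite -homX -fX // => /hK[m [Mm sm] fm].
exists m, (m^-1 * g ^+ (p ^ e)); split=> //; last by rewrite mulVKg.
have sX : s j.+1 (g ^+ (p ^ e)) by apply: subgroupX.
rewrite -fK; split; first by apply: sMul => //; apply: sV.
by rewrite fM ?fV ?fm ?mulVg //; apply: sV.
Qed.

(** The p^k-th powers of s_j lie not only in M but in its core, s_j being normal.
    This allows commutators with an element of s_(j+1) to be pushed down the
    series s_i (core M) by taking p-power powers, until they reach the core. *)
Lemma maximal_finite_exponent j : (j <= n)%N ->
  exists k, forall g, s j g -> M (g ^+ (p ^ k)).
Proof.
have [M1 MM MV] := sM; have nC := normal_core sM.
elim: j => [|j IHj] jn.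
  by exists 0%N => g; case: cs => -> _ _ _ ->; rewrite expg1n.
have [k Mk] := IHj (ltnW jn).
pose K i := join (s i) (core M).
have CK i : (i <= n)%N -> core M `<=` K i.
  by move=> i_n; apply: join_subr; case: nC => // _ _; case: (cs_subgroup cs i_n).
have sK i : s i `<=` K i by apply: join_subl; case: nC => -[].
have nK i : (i <= n)%N -> normal (K i).
  by move=> i_n; apply: normal_join => //; apply: cs_normal.
have Cpow w : s j w -> core M (w ^+ (p ^ k)).
  by move=> sw a; rewrite conjXg; apply: Mk; apply: (cs_conj cs (ltnW jn) sw).
have tor g : s j.+1 g -> exists u, M (g ^+ (p ^ u)).
  move=> sg; have K0 c : K 0%N c -> core M c.
    case=> t Ct; case: cs => -> _ _ _ /= /mulg1_eq ct.
    by rewrite -[c]invgK ct; case: nC => -[_ _ CV] _; apply: CV.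
  have [|u Mu] := @maximal_power_normalizing (g ^+ ((p ^ k) ^ j)).
    move=> v; apply/K0; apply: comm_power_descent => [i ij|i ij|i a b ij|c|w].
    - by apply: nK; apply: leq_trans ij (ltnW jn).
    - move=> c [t Ct sct]; exists t => //.
      by apply: (cs_subS cs) sct; apply: leq_trans (ltnW jn).
    - move=> [t Ct sat]; have i_n : (i < n)%N by apply: leq_trans ij (ltnW jn).
      have [Q [f [_ fK]]] := quotient_exists (nK i (ltnW i_n)).
      apply/fK; have -> : f [~ a, b] = f [~ a * t, b].
        have /fK ft := CK i (ltnW i_n) t Ct.
        by rewrite !homR homM ft mulg1.
      by apply/fK/sK/(cs_comm cs).
    - move=> [t Ct sct]; apply: CK => //.
      have [Q [f [_ fK]]] := quotient_exists nC.
      have /fK ft := Ct; apply/fK; have /fK := Cpow _ sct.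
      by rewrite !homX homM ft mulg1.
    - by apply/sK/(cs_comm' cs).
  by exists (k * j + u)%N; rewrite expnD expgnA expnM.
have [e eP] := bounded_power jn tor.
exists (e + k * j)%N => g sg; rewrite expnD expgnA.
have [m [w [Mm sw ->]]] := eP g sg; rewrite expnM.
exact: (power_coset_descent sM (ltnW jn) Mk).
Qed.

End Bounded.
End MaximalAvoiding.

(** If x has a positive power in Y, take the least one: its exponent is divisible
    by a prime of pi, as Y is isolated.  Otherwise let i be the last index such
    that x has no positive power in s_i Y.  Some power y of x lies in
    s_(i+1) Y, which normalises s_i Y; then any prime p of pi serves, with
    Z = s_i Y <y^p>, as y in Z would give a nonzero power of y in s_i Y. *)
Lemma exists_power_outside (pi : nat_pred) p Y x : subgroup Y ->
  isolated pi^' Y -> prime p -> p \in pi -> ~ Y x ->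
  exists q t (Z : set X), [/\ prime q, q \in pi, subgroup Z & Y `<=` Z] /\
    ~ Z (x ^+ t) /\ Z ((x ^+ t) ^+ q).
Proof.
move=> sY isoY p_pr p_pi Yx.
have [[m m0 Ym]|noP] := pselect (exists2 m, (0 < m)%N & Y (x ^+ m)).
  have exP : exists m, (0 < m)%N && `[< Y (x ^+ m) >].
    by exists m; rewrite m0; apply/asboolP.
  have [k /andP[k0 /asboolP Yk] kmin] := ex_minnP exP.
  have [q /andP[q_pr q_k] q_pi] : exists2 q, prime q && (q %| k) & q \in pi.
    apply: contrapT => nq; apply/Yx/(isolated_root isoY _ Yk).
    apply/pnatP => // q q_pr q_k; apply/negP => q_pi; apply: nq.
    by exists q; rewrite ?q_pr.
  have kq0 : (0 < k %/ q)%N by rewrite divn_gt0 ?prime_gt0 // dvdn_leq.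
  exists q, (k %/ q)%N, Y; split; first by split=> //; apply: subset_refl.
  rewrite -expgnA divnK //; split=> // Ykq.
  have := kmin (k %/ q)%N; rewrite kq0 asboolT // leqNgt ltn_Pdiv ?prime_gt1 //.
  by move/(_ isT).
pose P i := exists2 m, (0 < m)%N & join (s i) Y (x ^+ m).
have [Y1 YM YV] := sY.
have nP0 : ~ P 0%N.
  move=> [m m0 [t Yt]]; case: cs => -> _ _ _ /= /mulg1_eq e; apply: noP.
  by exists m => //; apply/(subgroupVE _ sY); rewrite e.
have Pn : P n by exists 1%N => //; exists 1 => //; rewrite (cs_top cs).
have [i [i_n nPi [m m0 Pm]]] : exists i, [/\ (i < n)%N, ~ P i & P i.+1].
  apply: contrapT => nex; suff : forall i, (i <= n)%N -> ~ P i by move/(_ n (leqnn n)).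
  elim=> // i IHi i_n Pi; apply: nex; exists i; split=> //; exact/IHi/ltnW.
set W := join (s i) Y in nPi; set y := x ^+ m in Pm.
have sW : subgroup W by apply: (subgroup_join_cs cs) => //; apply: ltnW.
have sW' : subgroup (join (s i.+1) Y) by apply: (subgroup_join_cs cs).
have [W1 WM WV] := sW.
have YW : Y `<=` W by apply: join_subr => //; case: (cs_subgroup cs (ltnW i_n)).
have siW : s i `<=` W by apply: join_subl.
have nW : join (s i.+1) Y `<=` normalizer W.
  apply: join_min; first exact: subgroup_normalizer.
    move=> z sz w; rewrite conjg_commg; apply: subgroupMr => //.
    by apply/siW/(cs_comm' cs).
  exact: subset_trans YW (subgroup_normalizes sW).
have nWy : cyclic (y ^+ p) `<=` normalizer W.
  apply: cyclic_min; first exact: subgroup_normalizer.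
  exact: nW _ (subgroupX p sW' Pm).
exists p, m, (join W (cyclic (y ^+ p))); split; last split.
- split=> //; first by apply: subgroup_join => //; apply: subgroup_cyclic.
  apply: subset_trans YW _; apply: join_subl.
  by case: (subgroup_cyclic (y ^+ p)).
- case=> _ [a [b ->]]; rewrite -(expgnA y p a) -(expgnA y p b) mulgA -expgS => Wab.
  have [|t t0 Wt] := cyclic_pow sW Wab; last first.
    by apply: nPi; exists (m * t)%N; rewrite ?muln_gt0 ?m0 // expgnA.
  (* The exponents 1 + p a and p b differ. *)
  apply/eqP => e; have : p %| 1.
    by rewrite -(dvdn_addl _ (dvdn_mulr a (dvdnn p))) add1n e dvdn_mulr.
  by rewrite dvdn1 => /eqP pe; rewrite pe in p_pr.
- by apply: join_subr (cyclic_id _) => //; apply: subgroup_cyclic.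
Qed.

End Separation.

(** The quotient by the core of a maximal subgroup M avoiding a power of x
    separates x from Y, since Y and the core both lie in M. *)
Lemma separable_isolated (C : groupType -> Prop) (X : groupType) (Y : set X) :
  root_class C -> (forall G : groupType, C G -> periodic G) ->
  bounded_nilpotent C X -> subgroup Y -> isolated (primes_of C)^' Y ->
  separable C Y.
Proof.
move=> C_root C_per [n [s [cs bd]]] sY isoY x Yx.
have [p pC] : exists p, p \in primes_of C.
  have [G CG [g g1]] := root_nontrivial C_root.
  have [m og] := C_per G CG g; have [m0 gm gmin] := og.
  have m1 : (1 < m)%N.
    by case: m {og gmin} m0 gm => [|[|m]] // _; rewrite expg1 => /g1.
  exists (pdiv m); rewrite inE /= pdiv_prime //=; apply/asboolP.
  by exists G, g, m; split=> //; apply: pdiv_dvd.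
have primeC q : q \in primes_of C -> prime q by rewrite inE => /andP[].
have [q [t [Z [[q_pr q_pi sZ YZ] [Zx Zxq]]]]] :=
  exists_power_outside cs sY isoY (primeC p pC) pC Yx.
have [M [sM ZM Mx Mmax]] := maximal_avoiding sZ Zx.
have [k Mk] := maximal_finite_exponent cs q_pr sM Mx (ZM _ Zxq) Mmax q_pi bd (leqnn n).
rewrite (cs_top cs) in Mk.
have [Q [f [fT fK]]] := quotient_exists (normal_core sM).
exists Q, f; split=> //.
  apply: (@root_quotient _ C_root _ n s q k 0 _ f) => //.
  - move=> u; have [y _ <-] : range f u by rewrite fT.
    by rewrite -homX; apply/fK => a; rewrite conjXg; apply: Mk.
  - by move=> y; case: cs => -> _ _ _ ->; rewrite hom1.
case=> y Yy fxy; have My : M y by apply/ZM/YZ.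
have [_ MM _] := sM; apply: Mx; apply: subgroupX => //.
rewrite -(mulVKg y x); apply: MM => //; apply: core_sub; apply/fK.
by rewrite homM homV fxy mulVg.
Qed.

Theorem theorem2p2 (C : groupType -> Prop) (X : groupType) (Y : set X)
    (C_root : root_class C)
    (C_periodic : forall G : groupType, C G -> periodic G)
    (X_bounded : bounded_nilpotent C X)
    (Y_subgroup : subgroup Y) :
  [/\ separable C (isolator (primes_of C)^' Y),
      isolator (primes_of C)^' Y = root_set (primes_of C)^' Y,
      Sep C X
    & torsion_free X (primes_of C)^' ->
      exists2 c : nat, has_nil_class Y c &
        has_nil_class (isolator (primes_of C)^' Y) c].
Proof.
have [n [s [cs _]]] := X_bounded.
have sep (Z : set X) : subgroup Z -> isolated (primes_of C)^' Z -> separable C Z.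
  exact: (separable_isolated C_root C_periodic X_bounded).
have eI := isolator_root_set (subgroup_root_set (primes_of C)^' cs Y_subgroup).
split=> //.
- by have [sI isoI] := isolatorP (primes_of C)^' Y; apply: sep.
- by rewrite eI => tfX; apply: nil_class_root_set cs tfX Y_subgroup.
Qed.
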